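(* Let $1\leq m\leq n-1$ be integers, let $s\in[m,n)$, and let $E\subseteq\mathbb{R}^n$. If $\dim_A E<s$, then there exists an $(m/s)$-Hölder continuous map $f:\mathbb{R}^m \to \mathbb{R}^n$ such that $E\subseteq f(\mathbb{R}^m)$.
   Context: A map $f:\mathbb{R}^m\to\mathbb{R}^n$ is $\alpha$-Hölder continuous ($0<\alpha\le 1$) if $\sup_{x\neq y}|f(x)-f(y)|/|x-y|^{\alpha}<\infty$, the supremum being over all pairs of distinct points of the domain. Assouad dimension: for a metric space $X$, $\beta>0$ and $C>1$, $X$ is $(C,\beta)$-homogeneous if for every bounded set $A\subseteq X$ and every $\delta\in(0,1)$ there exist sets $A_1,\dots,A_N\subseteq X$ with $A\subseteq A_1\cup\dots\cup A_N$, $\operatorname{diam}A_i\le\delta\operatorname{diam}A$ for all $i$, and $\operatorname{card}\{A_1,\dots,A_N\}\le C\delta^{-\beta}$. $X$ is $\beta$-homogeneous if it is $(C,\beta)$-homogeneous for some $C>1$. Then $\dim_A X:=\inf\{\beta>0: X\text{ is }\beta\text{-homogeneous}\}\in[0,\infty]$. *)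

(* Defs.v *)
From HB Require Import structures.
From mathcomp Require Import all_boot all_order all_algebra finmap.
From mathcomp Require Import all_classical all_reals all_analysis.
From mathcomp Require Import ring.

Set Implicit Arguments.
Unset Strict Implicit.
Unset Printing Implicit Defensive.

Import Order.TTheory GRing.Theory Num.Theory.
Import numFieldNormedType.Exports.

Local Open Scope classical_set_scope.
Local Open Scope ring_scope.

(* Row vectors under a fresh name: the library's norm on 'rV[R]_n is the sup
   norm, whereas R^n carries the Euclidean norm here. *)
Definition euclid (R : realType) (n : nat) : Type := 'rV[R]_n.

HB.instance Definition _ (R : realType) (n : nat) :=
  GRing.Lmodule.copy (euclid R n) 'rV[R]_n.

Definition euclid_norm (R : realType) (n : nat) (x : euclid R n) : R :=
  Num.sqrt (\sum_(i < n) x ord0 i ^+ 2).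

Section euclid_normed.
Context {R : realType} {n : nat}.
Implicit Types x y : euclid R n.

Let sumsq_ge0 x : 0 <= \sum_(i < n) x ord0 i ^+ 2.
Proof. by apply: sumr_ge0 => i _; exact: sqr_ge0. Qed.

Lemma euclid_norm_ge0 x : 0 <= euclid_norm x.
Proof. exact: sqrtr_ge0. Qed.

Lemma sqr_euclid_norm x : euclid_norm x ^+ 2 = \sum_(i < n) x ord0 i ^+ 2.
Proof. by rewrite sqr_sqrtr. Qed.

Lemma euclid_norm_eq0 x : euclid_norm x = 0 -> x = 0.
Proof.
move=> x0; have := sqr_euclid_norm x; rewrite x0 expr0n /= => /esym/eqP.
rewrite psumr_eq0 => [/allP sx0|i _]; last exact: sqr_ge0.
apply/rowP => i; rewrite [RHS]mxE; apply/eqP.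
by rewrite -sqrf_eq0; apply: sx0; rewrite mem_index_enum.
Qed.

Lemma euclid_normZ (l : R) x : euclid_norm (l *: x) = `|l| * euclid_norm x.
Proof.
rewrite /euclid_norm -sqrtr_sqr -sqrtrM ?sqr_ge0// mulr_sumr.
by congr Num.sqrt; apply: eq_bigr => i _; rewrite mxE exprMn.
Qed.

Lemma euclid_cauchy_schwarz x y :
  \sum_(i < n) x ord0 i * y ord0 i <= euclid_norm x * euclid_norm y.
Proof.
have [x0|x0] := eqVneq (euclid_norm x) 0.
  rewrite x0 mul0r big1// => i _.
  by rewrite (euclid_norm_eq0 x0) mxE mul0r.
have [y0|y0] := eqVneq (euclid_norm y) 0.
  rewrite y0 mulr0 big1// => i _.
  by rewrite (euclid_norm_eq0 y0) mxE mulr0.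
set a := euclid_norm x in x0 *; set b := euclid_norm y in y0 *.
have ab0 : 0 < a * b by rewrite mulr_gt0// lt_neqAle eq_sym ?x0 ?y0 euclid_norm_ge0.
have : 0 <= \sum_(i < n) (b * x ord0 i - a * y ord0 i) ^+ 2.
  by apply: sumr_ge0 => i _; exact: sqr_ge0.
have -> : \sum_(i < n) (b * x ord0 i - a * y ord0 i) ^+ 2 =
    (a * b) * (a * b - \sum_(i < n) x ord0 i * y ord0 i) *+ 2.
  transitivity (b ^+ 2 * (\sum_(i < n) x ord0 i ^+ 2)
      - (a * b) * (\sum_(i < n) x ord0 i * y ord0 i) *+ 2
      + a ^+ 2 * (\sum_(i < n) y ord0 i ^+ 2)).
    rewrite !mulr_sumr -sumrMnl -sumrB -big_split /=; apply: eq_bigr => i _.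
    by ring.
  by rewrite -!sqr_euclid_norm -/a -/b; ring.
by rewrite pmulrn_lge0// pmulr_rge0// subr_ge0.
Qed.

Lemma euclid_norm_triangle x y :
  euclid_norm (x + y) <= euclid_norm x + euclid_norm y.
Proof.
rewrite -(ler_pXn2r (ltn0Sn 1)) ?nnegrE ?addr_ge0 ?euclid_norm_ge0//.
rewrite sqrrD !sqr_euclid_norm.
under eq_bigr do rewrite mxE sqrrD.
rewrite !big_split /= lerD2r lerD2l -mulr2n.
by rewrite lerMn2r euclid_cauchy_schwarz.
Qed.

End euclid_normed.

HB.instance Definition _ (R : realType) (n : nat) :=
  Lmodule_isNormed.Build R (euclid R n)
    euclid_norm_triangle euclid_normZ euclid_norm_eq0.

Section euclid_metric.
Context {R : realType} {n : nat}.

Let dist (x y : euclid R n) : R := `|y - x|.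

Let dist_ge0 x y : 0 <= dist x y.
Proof. exact: normr_ge0. Qed.

Let dist_positivity x y : dist x y = 0 -> x = y.
Proof. by move/normr0_eq0/eqP; rewrite subr_eq0 => /eqP. Qed.

Let ballEdist x d : ball x d = [set y | dist x y < d].
Proof.
by rewrite -ball_normE; apply/seteqP; split => y /=; rewrite /dist distrC.
Qed.

HB.instance Definition _ := @PseudoMetric_isMetric.Build R (euclid R n)
  dist dist_ge0 dist_positivity ballEdist.

End euclid_metric.

(* The added 0 only matters for the empty set, whose diameter is thus 0. *)
Definition diam (R : realType) (T : metricType R) (A : set T) : \bar R :=
  ereal_sup (0%E |` [set (mdist x y)%:E | x in A & y in A]).

(* The metric space is the subset X of T with the restricted distance; its
   bounded subsets are those of finite diameter. *)
Definition homogeneous (R : realType) (T : metricType R) (X : set T)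
    (C beta : R) : Prop :=
  forall (A : set T) (delta : R),
    A `<=` X -> (diam A < +oo)%E -> 0 < delta < 1 ->
    exists F : {fset (set T)},
      [/\ forall B, B \in F -> B `<=` X,
          A `<=` \bigcup_(B in [set` F]) B,
          forall B, B \in F -> (diam B <= delta%:E * diam A)%E &
          #|` F|%:R <= C * delta `^ (- beta)].

Definition assouad_dim (R : realType) (T : metricType R) (X : set T) : \bar R :=
  ereal_inf [set beta%:E | beta in
    [set beta : R | 0 < beta /\ exists C : R, 1 < C /\ homogeneous X C beta]].

Definition hoelder_continuous (R : realType) (S T : metricType R)
    (alpha : R) (f : S -> T) : Prop :=
  [/\ 0 < alpha, alpha <= 1 &
      (ereal_sup [set (mdist (f p.1) (f p.2) / mdist p.1 p.2 `^ alpha)%:E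
                 | p in [set p : S * S | p.1 <> p.2]] < +oo)%E].

(* Main.v *)
Require Import Defs.
From mathcomp Require Import all_boot all_order all_algebra finmap.
From mathcomp Require Import all_classical all_reals all_analysis.
From mathcomp Require Import ring lra.

Import Order.TTheory GRing.Theory Num.Theory.
Import numFieldNormedType.Exports.

Local Open Scope classical_set_scope.
Local Open Scope ring_scope.

(** It suffices to find [h : E -> R^m] with [|x - y| <= 4 |h x - h y|^(m/s)]:
    then [h x |-> x] is Hoelder continuous on [h E], and McShane's formula
    extends each of its coordinates to [R^m]. Choose [beta < s] such that [E]
    is [beta]-homogeneous, a large [N] and [r = 1 / (4 N)]. A set of diameter
    [D] splits into at most [C r^(-beta m/s) <= N^m] pieces of diameter
    [r^(m/s) D], which can be labelled by vectors in [{1..N}^m]. Iterating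
    codes the points of a bounded part of [E] by sequences of labels, read by
    [h] as base-[r] expansions. Since [r N / (1 - r) <= 1/2], the tail of an
    expansion never compensates a first differing digit. *)

(** * Diameters, covers and codings of homogeneous sets *)

Lemma mdist_le_diam {R : realType} {T : metricType R} {A : set T} {x y : T} :
  A x -> A y -> ((mdist x y)%:E <= diam A)%E.
Proof.
move=> Ax Ay; apply: ereal_sup_ubound; right.
by exists x => //; exists y.
Qed.

Lemma diam_le {R : realType} {T : metricType R} {A : set T} {D : R} :
  0 <= D -> (forall x y, A x -> A y -> mdist x y <= D) -> (diam A <= D%:E)%E.
Proof.
move=> D0 AD; apply: ge_ereal_sup => _ [->|[x Ax [y Ay <-]]].
  by rewrite lee_fin.
by rewrite lee_fin; exact: AD.
Qed.

(** A point is labelled by the index of the first piece of a cover that contains it, so equal labels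
    put two points into one piece. The bound on the number of pieces keeps these indices below
    [#|L|]; outside [A] the label may be the default [l0]. *)
Lemma homogeneous_label {R : realType} {T : metricType R} {X : set T}
    {C beta delta : R} {L : finType} (l0 : L) {A : set T} {D : R} :
  homogeneous X C beta -> 0 < delta < 1 ->
  C * delta `^ (- beta) <= #|L|%:R ->
  A `<=` X -> 0 <= D -> (forall x y, A x -> A y -> mdist x y <= D) ->
  exists l : T -> L,
    forall x y, A x -> A y -> l x = l y -> mdist x y <= delta * D.
Proof.
move=> homX delta01 CL AX D0 AD.
have diamA : (diam A <= D%:E)%E by exact: diam_le.
have [F [_ AF Fdiam cardF]] :=
  homX A delta AX (le_lt_trans diamA (ltry D)) delta01.
pose i x := find (fun B : set T => `[< B x >]) F.
have hasF x : A x -> has (fun B : set T => `[< B x >]) F.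
  by move=> /AF[B /= BF Bx]; apply/hasP; exists B => //; exact/asboolP.
have iL x : A x -> (i x < size (enum L))%N.
  move=> /hasF; rewrite has_find => /leq_trans; apply.
  by rewrite -cardE -(ler_nat R) (le_trans cardF).
exists (fun x => nth l0 (enum L) (i x)) => x y Ax Ay /eqP.
rewrite nth_uniq ?iL ?enum_uniq// => /eqP ixy.
pose B := nth set0 F (i x).
have BF : B \in F by apply: mem_nth; rewrite -has_find hasF.
have Bx : B x by apply/asboolP; exact: nth_find (hasF _ Ax).
have By : B y by rewrite /B ixy; apply/asboolP; exact: nth_find (hasF _ Ay).
rewrite -lee_fin (le_trans (mdist_le_diam Bx By))//.
rewrite (le_trans (Fdiam _ BF))// EFinM lee_pmul2l// ?lte_fin.
by case/andP: delta01.
Qed.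

(* The cells of generation [k] are the fibres of the word of the first [k]
   digits; each cell is subdivided independently of the others. *)
Lemma homogeneous_coding {R : realType} {T : metricType R} {X : set T}
    {C beta delta : R} {L : finType} (l0 : L) {A : set T} {D : R} :
  homogeneous X C beta -> 0 < delta < 1 ->
  C * delta `^ (- beta) <= #|L|%:R ->
  A `<=` X -> 0 <= D -> (forall x y, A x -> A y -> mdist x y <= D) ->
  exists e : T -> nat -> L, forall x y k, A x -> A y ->
    (forall i, (i < k)%N -> e x i = e y i) -> mdist x y <= delta ^+ k * D.
Proof.
move=> homX delta01 CL AX D0 AD.
have delta0 : 0 <= delta by case/andP: delta01 => /ltW.
(* The conditions on the pair stay behind the existential, so that choice yields one labelling for
   every pair; the constant [l0] serves pairs that violate them. *)
have /choice[lab labP] : forall BD : set T * R, exists l : T -> L,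
    BD.1 `<=` X -> 0 <= BD.2 ->
    (forall x y, BD.1 x -> BD.1 y -> mdist x y <= BD.2) ->
    forall x y, BD.1 x -> BD.1 y -> l x = l y -> mdist x y <= delta * BD.2.
  move=> [B d] /=.
  have [BX|] := pselect (B `<=` X); last by exists (fun=> l0).
  have [d0|] := pselect (0 <= d); last by exists (fun=> l0).
  have [Bd|] := pselect (forall x y, B x -> B y -> mdist x y <= d);
    last by exists (fun=> l0).
  by have [l lP] := homogeneous_label l0 homX delta01 CL BX d0 Bd; exists l.
pose cell (c : T -> seq L) w := [set y | A y /\ c y = w].
(* Words grow at the head: the newest digit comes first and is read off the labelling of the current
   cell of [x]. *)
pose step k c x := lab (cell c (c x), delta ^+ k * D) x :: c x.
pose word := fix word k : T -> seq L :=
  if k is k'.+1 then step k' (word k') else fun=> [::].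
have wordP k : forall x y, A x -> A y -> word k x = word k y ->
    mdist x y <= delta ^+ k * D.
  elim: k => [x y Ax Ay _|k IHk x y Ax Ay]; first by rewrite expr0 mul1r AD.
  (* Equal words have equal tails, so [x] and [y] share a cell of generation [k] and their newest
     labels come from the same labelling. *)
  rewrite /= /step => -[+ cxy]; rewrite -cxy exprS -mulrA.
  apply: (labP (cell (word k) (word k x), delta ^+ k * D)) => /=.
  - by move=> z [/AX].
  - by rewrite mulr_ge0// exprn_ge0.
  - by move=> z t [Az cz] [At ct]; apply: IHk; rewrite // cz ct.
  - by split.
  - by split.
exists (fun x k => head l0 (word k.+1 x)) => x y k Ax Ay exy.
apply: wordP => //; elim: k exy => // k IHk exy.
have cxy : word k x = word k y by apply: IHk => i ik; apply: exy; exact: ltnW.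
by have := exy k (ltnSn k); rewrite /= /step cxy /= => ->.
Qed.

(** * Base-[r] expansions *)

Definition expansion {R : realType} (r : R) (a : nat -> R) : R :=
  limn (series (fun i => r ^+ i * a i)).

Lemma is_cvg_expansion {R : realType} {r M : R} {a : nat -> R} :
  0 <= r < 1 -> (forall i, 0 <= a i <= M) ->
  cvgn (series (fun i => r ^+ i * a i)).
Proof.
move=> /andP[r0 r1] aM.
have M0 : 0 <= M by have /andP[/le_trans a0 /a0] := aM 0%N.
apply: (@series_le_cvg _ _ (geometric M r)) => [i|i|i|].
- by rewrite mulr_ge0 ?exprn_ge0//; case/andP: (aM i).
- by rewrite /geometric /= mulr_ge0 ?exprn_ge0.
- by rewrite /geometric /= mulrC ler_wpM2r ?exprn_ge0//; case/andP: (aM i).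
- by apply: is_cvg_geometric_series; rewrite ger0_norm.
Qed.

Lemma expansion_ge0_le {R : realType} {r M : R} {a : nat -> R} :
  0 <= r < 1 -> (forall i, 0 <= a i <= M) ->
  0 <= expansion r a <= M / (1 - r).
Proof.
move=> r01 aM; have cva := is_cvg_expansion r01 aM.
move: (r01) => /andP[r0 r1]; apply/andP; split.
  apply: limr_ge => //; near=> n; apply: sumr_ge0 => i _.
  by rewrite mulr_ge0 ?exprn_ge0//; case/andP: (aM i).
have rn1 : `|r| < 1 by rewrite ger0_norm.
rewrite -(cvg_lim _ (@cvg_geometric_series _ M r rn1))//.
apply: lim_series_le => //; first exact: is_cvg_geometric_series.
move=> i; rewrite /geometric /= mulrC ler_wpM2r ?exprn_ge0//.
by case/andP: (aM i).
Unshelve. all: by end_near. Qed.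

Lemma expansionS {R : realType} {r M : R} {a : nat -> R} :
  0 <= r < 1 -> (forall i, 0 <= a i <= M) ->
  expansion r a = a 0%N + r * expansion r (fun i => a i.+1).
Proof.
move=> r01 aM; have cva := is_cvg_expansion r01 (fun i => aM i.+1).
apply: cvg_lim => //; rewrite -cvg_shiftS /=.
have -> : (fun n => series (fun i => r ^+ i * a i) n.+1) =
    (fun n => a 0%N + r * series (fun i => r ^+ i * a i.+1) n).
  apply/funext => n; rewrite /series /= big_nat_recl// expr0 mul1r; congr +%R.
  by rewrite mulr_sumr; apply: eq_bigr => i _; rewrite exprS mulrA.
by apply: cvgD; [exact: cvg_cst|apply: cvgMr].
Qed.

(** Splitting off the [k] common digits leaves a factor [r ^+ k]. The next digits then differ by at
    least 1, while both remaining tails lie in [[0, 1/2]] and cancel at most half of that. *)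
Lemma expansion_separated {R : realType} {r M : R} {a b : nat -> R} {k : nat} :
  0 <= r < 1 -> r * (M / (1 - r)) <= 2^-1 ->
  (forall i, 0 <= a i <= M) -> (forall i, 0 <= b i <= M) ->
  (forall i, (i < k)%N -> a i = b i) -> 1 <= `|a k - b k| ->
  r ^+ k / 2 <= `|expansion r a - expansion r b|.
Proof.
move=> r01 rM; have r0 : 0 <= r by case/andP: r01.
elim: k a b => [|k IHk] a b aM bM ab abk;
  rewrite (expansionS r01 aM) (expansionS r01 bM).
- have := expansion_ge0_le r01 (fun i => aM i.+1).
  have := expansion_ge0_le r01 (fun i => bM i.+1).
  set x := expansion _ _; set y := expansion _ _.
  move=> /andP[x0 xM] /andP[y0 yM].
  have rx0 := mulr_ge0 r0 x0; have rxM := ler_wpM2l r0 xM.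
  have ry0 := mulr_ge0 r0 y0; have ryM := ler_wpM2l r0 yM.
  rewrite expr0 mul1r.
  have [u|u] := lerP 0 (a 0%N - b 0%N); [rewrite ger0_norm// in abk|
    rewrite ltr0_norm// in abk]; rewrite ler_normr; apply/orP;
    [left|right]; lra.
- rewrite (ab 0%N)// opprD addrACA subrr add0r -mulrBr normrM (ger0_norm r0).
  rewrite exprS -mulrA ler_wpM2l//; apply: IHk => // i ik.
  exact: ab.
Qed.

(** * Extension of real-valued Hoelder maps *)

(** For [t = w / (u + v)] in [[0, 1]] one has [t <= t ^ alpha]; the fractions for [w = u] and
    [w = v] add up to 1. *)
Lemma powR_subadditive {R : realType} {alpha u v : R} :
  0 <= alpha <= 1 -> 0 <= u -> 0 <= v ->
  (u + v) `^ alpha <= u `^ alpha + v `^ alpha.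
Proof.
move=> /andP[a0 a1] u0 v0.
have [->|un0] := eqVneq u 0; first by rewrite add0r lerDr powR_ge0.
have uv0 : 0 < u + v by rewrite ltr_wpDr// lt_neqAle eq_sym un0.
have frac w : 0 <= w -> w <= u + v ->
    w / (u + v) * (u + v) `^ alpha <= w `^ alpha.
  move=> w0 wuv; have [->|wn0] := eqVneq w 0; first by rewrite !mul0r powR_ge0.
  rewrite -{2}(divfK (lt0r_neq0 uv0) w) powRM ?divr_ge0// ?(ltW uv0)//.
  rewrite ler_wpM2r ?powR_ge0// ger1_powR// ler_pdivrMr// mul1r wuv andbT.
  by rewrite divr_gt0// lt_neqAle eq_sym wn0.
apply: le_trans (lerD (frac u u0 _) (frac v v0 _)); rewrite ?lerDl ?lerDr//.
by rewrite -mulrDl -mulrDl divff ?mul1r// gt_eqF.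
Qed.

(** By subadditivity [mdist ^ alpha] is again a metric, and for it McShane's infimum of
    [g x + L * mdist p (h x) ^ alpha] extends a Lipschitz function with the same constant. *)
Lemma hoelder_extension {R : realType} {S : metricType R} {T : Type}
    {X : set T} {h : T -> S} {g : T -> R} {L alpha : R} :
  0 <= L -> 0 < alpha <= 1 -> X !=set0 ->
  (forall x y, X x -> X y ->
    `|g x - g y| <= L * mdist (h x) (h y) `^ alpha) ->
  exists f : S -> R, (forall x, X x -> f (h x) = g x) /\
    forall p q, `|f p - f q| <= L * mdist p q `^ alpha.
Proof.
move=> L0 /andP[alpha_gt0 alpha1] [x0 Xx0] gh; have alpha0 := ltW alpha_gt0.
have alpha01 : 0 <= alpha <= 1 by rewrite alpha0.
pose V p := [set g x + L * mdist p (h x) `^ alpha | x in X].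
have dist_le (p q z : S) :
    L * mdist p z `^ alpha <= L * mdist p q `^ alpha + L * mdist q z `^ alpha.
  rewrite -mulrDr ler_wpM2l//.
  apply: le_trans (powR_subadditive alpha01 _ _); rewrite ?mdist_ge0//.
  by rewrite ge0_ler_powR ?nnegrE ?addr_ge0 ?mdist_ge0// metric_triangle.
have V0 p : V p !=set0 by exists (g x0 + L * mdist p (h x0) `^ alpha); exists x0.
(* This bound makes the infimum finite, and at [p = h x] it gives the lower half of
   [f (h x) = g x]. *)
have Vlb p x : X x -> lbound (V p) (g x - L * mdist p (h x) `^ alpha).
  move=> Xx _ [y Xy <-]; rewrite lerBlDr -addrA -lerBlDl.
  apply: le_trans (ler_norm _) (le_trans (gh _ _ Xx Xy) _).
  by rewrite addrC (metric_sym p (h x)) dist_le.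
have Vge p x : X x -> inf (V p) <= g x + L * mdist p (h x) `^ alpha.
  move=> Xx; apply: ge_inf; last by exists x.
  by exists (g x - L * mdist p (h x) `^ alpha); exact: Vlb.
exists (fun p => inf (V p)); split=> [x Xx|].
  have an0 : alpha != 0 by rewrite gt_eqF.
  apply/eqP; rewrite eq_le; apply/andP; split.
    by rewrite (le_trans (Vge _ _ Xx))// mdistxx powR0// mulr0 addr0.
  apply: lb_le_inf => //.
  by have := Vlb (h x) x Xx; rewrite mdistxx powR0// mulr0 subr0.
suff half p q : inf (V p) - inf (V q) <= L * mdist p q `^ alpha.
  move=> p q; rewrite ler_norml half andbT lerNl opprB metric_sym.
  exact: half.
rewrite lerBlDl -lerBlDr; apply: lb_le_inf => // _ [x Xx <-].
rewrite lerBlDr (le_trans (Vge p x Xx))// -addrA lerD2l addrC.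
exact: dist_le.
Qed.

(** * Euclidean distance and coordinates *)

Lemma ler_coord_euclid_norm {R : realType} {n : nat} (x : euclid R n) (i : 'I_n) :
  `|x ord0 i| <= `|x|.
Proof.
rewrite -[leLHS]sqrtr_sqr ler_sqrt; last by apply: sumr_ge0 => j _; exact: sqr_ge0.
by rewrite (bigD1 i)//= lerDl; apply: sumr_ge0 => j _; exact: sqr_ge0.
Qed.

Lemma ler_euclid_norm_sum {R : realType} {n : nat} (x : euclid R n) :
  `|x| <= \sum_(i < n) `|x ord0 i|.
Proof.
have s0 : 0 <= \sum_(i < n) `|x ord0 i| by exact: sumr_ge0.
rewrite -(ler_pXn2r (ltn0Sn 1)) ?nnegrE// [leLHS]sqr_euclid_norm expr2 mulr_suml.
apply: ler_sum => i _; rewrite -real_normK ?num_real//.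
by rewrite expr2 ler_wpM2l// (bigD1 i)//= lerDl sumr_ge0.
Qed.

Lemma ler_coord_mdist {R : realType} {n : nat} (x y : euclid R n) (i : 'I_n) :
  `|x ord0 i - y ord0 i| <= mdist x y.
Proof.
by have := ler_coord_euclid_norm (y - x) i; rewrite 2!mxE distrC.
Qed.

Lemma ler_mdist_sum {R : realType} {n : nat} (x y : euclid R n) :
  mdist x y <= \sum_(i < n) `|x ord0 i - y ord0 i|.
Proof.
rewrite (le_trans (ler_euclid_norm_sum (y - x)))//.
by apply: ler_sum => i _; rewrite 2!mxE distrC.
Qed.

(** * Choice of the base and embedding into [R^m] *)

(** With [N = M.+1] and [u = m beta / s < m], the left side is [C 4^u N^u]. A large [N^(m - u)]
    absorbs [C 4^u]; equality would hold at [B]. *)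
Lemma exists_branching {R : realType} {m : nat} {s beta C : R} :
  (0 < m)%N -> 0 < s -> 0 < beta < s -> 0 < C ->
  exists M : nat,
    C * ((4 * M.+1%:R)^-1 `^ (m%:R / s)) `^ (- beta) <= (M.+1 ^ m)%:R.
Proof.
move=> m0 s0 /andP[b0 bs] C0; pose u := m%:R * beta / s.
have um : 0 < m%:R - u.
  by rewrite subr_gt0 /u -mulrA gtr_pMr ?ltr0n// ltr_pdivrMr ?mul1r.
pose B := (C * 4 `^ u) `^ (m%:R - u)^-1; exists (Num.truncn B).
set N := (Num.truncn B).+1%:R.
have N0 : 0 < N :> R by rewrite ltr0n.
have BN : B <= N by apply/ltW/truncnS_gt.
have -> : ((4 * N)^-1 `^ (m%:R / s)) `^ (- beta) = 4 `^ u * N `^ u.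
  rewrite -powRrM -powR_inv1 ?mulr_ge0// ?ltW// -powRrM -powRM ?ltW//.
  by congr powR; rewrite /u; field; rewrite gt_eqF.
rewrite natrX -powR_mulrn ?(ltW N0)// -/N -[X in _ <= N `^ X](subrK u).
rewrite powRD; last by rewrite (gt_eqF N0) implybT.
rewrite mulrA ler_wpM2r ?powR_ge0//.
have -> : C * 4 `^ u = B `^ (m%:R - u).
  by rewrite /B -powRrM mulVf ?gt_eqF// powRr1// mulr_ge0 ?powR_ge0 ?ltW.
by rewrite ge0_ler_powR ?nnegrE ?powR_ge0 ?(ltW um) ?(ltW N0).
Qed.

Lemma exists_expr_lt {R : realType} {z e : R} :
  0 <= z < 1 -> 0 < e -> exists k, z ^+ k < e.
Proof.
move=> /andP[z0 z1] e0.
have /cvgrPdist_lt/(_ e e0)[k _ /(_ k (leqnn k))] :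
    (GRing.exp z : R ^nat) @ \oo --> 0 by apply: cvg_expr; rewrite ger0_norm.
by rewrite /= sub0r normrN ger0_norm ?exprn_ge0// => zk; exists k.
Qed.

Lemma ler1_dist_natr {R : numDomainType} {p q : nat} :
  p != q -> 1 <= `|p%:R - q%:R : R|.
Proof.
wlog pq : p q / (p < q)%N => [wlog_lt|_].
  move=> npq; have [pq|qp|pq] := ltngtP p q; first exact: wlog_lt.
    by rewrite distrC wlog_lt// eq_sym.
  by rewrite pq eqxx in npq.
by rewrite distrC -natrB ?(ltnW pq)// ger0_norm// ler1n subn_gt0.
Qed.

(* Points are coded relative to a ball of radius [delta ^- K x] containing
   them. The leading term of [h x] has size [r ^- K x], as no digit is zero, and
   dominates [h y] whenever [K y < K x]. *)
Lemma homogeneous_embedding {R : realType} {T : metricType R} {X : set T}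
    {C beta alpha : R} {m M : nat} (r := (4 * M.+1%:R)^-1 : R) :
  homogeneous X C beta -> (0 < m)%N -> 0 < alpha <= 1 ->
  C * (r `^ alpha) `^ (- beta) <= (M.+1 ^ m)%:R ->
  exists h : T -> euclid R m, forall x y, X x -> X y ->
    mdist x y <= 4 * mdist (h x) (h y) `^ alpha.
Proof.
move=> homX m0 /andP[alpha0 alpha1] CM.
have [[x0 Xx0]|X0] := pselect (X !=set0); last first.
  by exists (fun=> 0) => x y Xx; case: X0; exists x.
have N1 : 1 <= M.+1%:R :> R by rewrite ler1n.
have r_gt0 : 0 < r by rewrite invr_gt0 mulr_gt0// ltr0n.
have rM : r * M.+1%:R = 4^-1 by rewrite /r invfM divfK ?pnatr_eq0.
have r14 : r <= 4^-1 by rewrite -rM ler_peMr// ltW.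
have r01 : 0 <= r < 1 by rewrite ltW//=; lra.
(* As [r N = 1/4] and [1 - r >= 3/4], the left side is at most [1/3]. *)
have rtail : r * (M.+1%:R / (1 - r)) <= 2^-1.
  by rewrite mulrA rM ler_pdivrMr; lra.
pose delta := r `^ alpha.
have delta_gt0 : 0 < delta by rewrite powR_gt0.
have delta1 : delta < 1.
  have <- : 1 `^ alpha = 1 :> R by rewrite powR1.
  rewrite gt0_ltr_powR ?nnegrE//; first exact: ltW.
  by case/andP: r01.
have delta01 : 0 < delta < 1 by rewrite delta_gt0.
pose L := {ffun 'I_m -> 'I_M.+1}.
have cardL : C * delta `^ (- beta) <= #|{: L}|%:R.
  by rewrite card_ffun !card_ord.
pose A K := [set x | X x /\ mdist x0 x <= delta ^- K].
have deltaV K : 0 <= 2 * delta ^- K :> R.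
  by rewrite mulr_ge0// invr_ge0 exprn_ge0// ltW.
have A_dist K x y : A K x -> A K y -> mdist x y <= 2 * delta ^- K.
  move=> [_ xK] [_ yK]; rewrite (le_trans (metric_triangle x x0 y))//.
  by rewrite metric_sym mulr_natl mulr2n lerD.
have AX K : A K `<=` X by move=> x [].
have /choice[e eP] := fun K => homogeneous_coding [ffun=> ord0]
  homX delta01 cardL (AX K) (deltaV K) (A_dist K).
have /choice[K KP] : forall x, exists K, mdist x0 x <= delta ^- K.
  move=> x.
  have [K] := exists_expr_lt (z := delta) (e := (mdist x0 x + 1)^-1)
    ltac:(by rewrite ltW) ltac:(by rewrite invr_gt0 ltr_wpDl// mdist_ge0).
  move=> dK; exists K.
  have : mdist x0 x + 1 <= delta ^- K.
    rewrite -[leLHS]invrK lef_pV2 ?posrE ?exprn_gt0// ?(ltW dK)//.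
    by rewrite invr_gt0 ltr_wpDl// mdist_ge0.
  by apply: le_trans; rewrite lerDl.
have AK x : X x -> A (K x) x by [].
(* The shift by one moves the digits from [0..M] to [1..N], which makes every expansion at least
   1. *)
pose a x j i : R := (e (K x) x i j).+1%:R.
have a1 x j i : 1 <= a x j i by rewrite ler1n.
have aM x j i : 0 <= a x j i <= M.+1%:R by rewrite ler0n /= ler_nat.
pose h x : euclid R m := \row_j (r ^- K x * expansion r (a x j)).
have hE x j : h x ord0 j = r ^- K x * expansion r (a x j) by rewrite mxE.
exists h.
have rV k : 0 < r ^- k by rewrite invr_gt0 exprn_gt0.
(* Separation in a single coordinate at scale [z] suffices: [z <= 2 * mdist (h x) (h y)], and
   [2 ^ alpha <= 2] turns the constant into [2 * 2 = 4]. *)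
have suff_coord x y j z : 0 <= z -> mdist x y <= 2 * z `^ alpha ->
    z / 2 <= `|h x ord0 j - h y ord0 j| ->
    mdist x y <= 4 * mdist (h x) (h y) `^ alpha.
  move=> z0 xyz zh; rewrite (le_trans xyz)//.
  have zH : z <= 2 * mdist (h x) (h y).
    rewrite mulrC -ler_pdivrMr// (le_trans zh)//.
    exact: ler_coord_mdist.
  apply: (@le_trans _ _ (2 * (2 * mdist (h x) (h y)) `^ alpha)).
    rewrite ler_pM2l// ge0_ler_powR ?nnegrE ?(ltW alpha0)//.
    by rewrite mulr_ge0// mdist_ge0.
  have -> : 4 = 2 * 2 :> R by rewrite -natrM.
  rewrite powRM ?mdist_ge0// -mulrA ler_pM2l// ler_wpM2r ?powR_ge0//.
  by apply: ler1_powR => //; rewrite ler1n.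
have deltaE k l : delta ^+ k * delta ^- l = (r ^+ k * r ^- l) `^ alpha.
  have r0 := ltW r_gt0.
  rewrite powRM ?exprn_ge0// ?(ltW (rV _))// -!powR_invn -?powR_mulrn ?powR_ge0//.
  by rewrite /delta -!powRrM; congr (powR _ _ * powR _ _); ring.
have j0 : 'I_m by exact: Ordinal m0.
have higher x y : X x -> X y -> (K x < K y)%N ->
    mdist x y <= 4 * mdist (h x) (h y) `^ alpha.
  move=> Xx Xy Kxy.
  have Axy : A (K y) x.
    have [_ xK] := AK _ Xx; split => //; apply: le_trans xK _.
    rewrite lef_pV2 ?posrE ?exprn_gt0// ler_wiXn2l ?(ltW delta1) ?(ltW delta_gt0)//.
    exact: ltnW.
  (* Both points lie in the ball of level [K y], whose scale is [r ^- K y]; any coordinate separates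
     them. *)
  apply: (suff_coord x y j0 (r ^- K y)); first exact: ltW.
    have := A_dist _ _ _ Axy (AK _ Xy).
    by have := deltaE 0%N (K y); rewrite !expr0 !mul1r => ->.
  have /andP[_ Sx] := expansion_ge0_le r01 (aM x j0).
  have Sy : 1 <= expansion r (a y j0).
    rewrite (expansionS r01 (aM y j0)) ler_wpDr//.
    by rewrite mulr_ge0 ?(ltW r_gt0)//; case/andP:
      (expansion_ge0_le r01 (fun i => aM y j0 i.+1)).
  have hy : r ^- K y <= h y ord0 j0 by rewrite hE ler_peMr// ltW.
  have hx : h x ord0 j0 <= r ^- K y / 2.
    rewrite hE (le_trans (ler_wpM2l (ltW (rV _)) Sx))//.
    apply: (@le_trans _ _ (r ^- K y * (r * (M.+1%:R / (1 - r))))); last first.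
      by rewrite ler_pM2l.
    rewrite [leRHS]mulrA ler_wpM2r//.
      by rewrite divr_ge0// subr_ge0 ltW//; case/andP: r01.
    (* Since [K x < K y], passing from [r ^- K y] to [r ^- K x] gains at least one factor [r]. *)
    rewrite -(ltn_predK Kxy) exprS invfM mulrAC mulVf ?gt_eqF// mul1r.
    rewrite lef_pV2 ?posrE ?exprn_gt0// ler_wiXn2l ?(ltW r_gt0)//.
      by case/andP: r01 => _ /ltW.
    by rewrite -ltnS (ltn_predK Kxy).
  by rewrite distrC (le_trans _ (ler_norm _))//; lra.
move=> x y Xx Xy; case: (ltngtP (K x) (K y)) => [|yx|Kxy].
- exact: higher.
- by rewrite metric_sym (metric_sym (h x)); exact: higher.
have [->|xy] := eqVneq x y; first by rewrite mdistxx mulr_ge0// powR_ge0.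
have Ayx : A (K x) y by rewrite Kxy; exact: AK.
(* If all digits agreed, [mdist x y] would be at most [2 * delta ^- K x * delta ^+ k] for every [k],
   hence 0. *)
have /ex_minnP[k exyk kmin] : exists k, e (K x) x k != e (K x) y k.
  apply/not_existsP => exy; have : 0 < mdist x y by rewrite mdist_gt0.
  rewrite lt_neqAle => /andP[/eqP xy0 xy_ge0].
  have D0 : 0 < 2 * delta ^- K x by rewrite mulr_gt0// invr_gt0 exprn_gt0.
  have [k] := exists_expr_lt (z := delta)
    (e := mdist x y / (2 * delta ^- K x)) ltac:(by rewrite ltW)
    ltac:(by rewrite divr_gt0// mdist_gt0).
  rewrite ltr_pdivlMr// ltNge => /negP; apply.
  apply: (eP (K x)) => //.
  by move=> i _; have /negP/negPn/eqP := exy i.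
have [j xyj] : exists j, e (K x) x k j != e (K x) y k j.
  apply/existsP; apply: contraNT exyk => /existsPn exy.
  by apply/eqP/ffunP => j; apply/eqP; have /negPn := exy j.
have agree i : (i < k)%N -> e (K x) x i = e (K x) y i.
  by move=> ik; apply/eqP; apply: contraLR ik => /kmin; rewrite -leqNgt.
(* Agreement of the first [k] digits bounds the distance by [2 * delta ^+ k * delta ^- K x], which
   is [2 * z ^ alpha] for this [z]. *)
apply: (suff_coord x y j (r ^+ k * r ^- K x)).
- by rewrite mulr_ge0 ?(ltW (rV _))// exprn_ge0// ltW.
- rewrite -deltaE mulrCA; exact: (eP (K x)).
rewrite !hE -Kxy -mulrBr normrM (gtr0_norm (rV _)) mulrAC mulrC ler_pM2l//.
apply: (expansion_separated (M := M.+1%:R)) => //.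
  by move=> i ik; rewrite /a -Kxy agree.
by apply: ler1_dist_natr; rewrite -Kxy eqSS.
Qed.

(** * Assembly of the Hoelder parametrization *)

Theorem theorem3p2 (R : realType) (m n : nat) (s : R) (E : set (euclid R n)) :
  (1 <= m)%N -> (m <= n - 1)%N ->
  m%:R <= s -> s < n%:R ->
  (assouad_dim E < s%:E)%E ->
  exists f : euclid R m -> euclid R n,
    hoelder_continuous (m%:R / s) f /\ E `<=` range f.
Proof.
move=> m0 _ ms _ dimE.
have s0 : 0 < s by rewrite (lt_le_trans _ ms)// ltr0n.
have alpha01 : 0 < m%:R / s <= 1.
  by rewrite divr_gt0 ?ltr0n//= ler_pdivrMr// mul1r.
move: (alpha01) => /andP[alpha0 alpha1].
have [_ [beta [beta0 [C [C1 homE]]] <-]] := ereal_inf_lt dimE.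
rewrite lte_fin => betas; have beta0s : 0 < beta < s by rewrite beta0.
have [M CM] := exists_branching m0 s0 beta0s (lt_trans ltr01 C1).
have [h hP] := homogeneous_embedding homE m0 alpha01 CM.
suff [f [fh fP]] : exists f : euclid R m -> euclid R n,
    (forall x, E x -> f (h x) = x) /\
    forall p q i, `|f p ord0 i - f q ord0 i| <= 4 * mdist p q `^ (m%:R / s).
  exists f; split; last by move=> x Ex; exists (h x) => //; exact: fh.
  (* The constant is 4 for each of the [n] coordinates, whose differences sum to a bound for the
     Euclidean distance. *)
  split => //; apply: (@le_lt_trans _ _ (n%:R * 4)%:E); last exact: ltry.
  apply: ge_ereal_sup => _ [[p q] /= /eqP pq <-].
  rewrite lee_fin ler_pdivrMr ?powR_gt0 ?mdist_gt0//.
  rewrite (le_trans (ler_mdist_sum _ _))//.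
  rewrite (le_trans (ler_sum _ (fun i _ => fP p q i)))//.
  by rewrite sumr_const card_ord -mulrA [leRHS]mulr_natl.
(* McShane's infimum runs over [E], so the empty set is treated apart, with a constant map. *)
have [E0|E0] := pselect (E !=set0); last first.
  exists (fun=> 0); split=> [x Ex|p q i]; first by case: E0; exists x.
  by rewrite subrr normr0 mulr_ge0// powR_ge0.
have /choice[f fP] : forall i : 'I_n, exists f : euclid R m -> R,
    (forall x, E x -> f (h x) = x ord0 i) /\
    forall p q, `|f p - f q| <= 4 * mdist p q `^ (m%:R / s).
  move=> i; apply: hoelder_extension => // x y Ex Ey.
  exact: le_trans (ler_coord_mdist _ _ _) (hP _ _ Ex Ey).
exists (fun p => \row_i f i p); split=> [x Ex|p q i].
  by apply/rowP => i; rewrite mxE (fP i).1.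
by rewrite 2!mxE; exact: (fP i).2.
Qed.
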